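(* Let $\alpha=(\alpha_1,\alpha_2,\ldots,\alpha_s)$ be a composition (a sequence of positive integers) satisfying $$\alpha_s\ge \alpha_1+\alpha_2+\cdots+\alpha_{s-1}.$$ Then the rank generating function $r(q;\alpha)$ is unimodal.
   Context: For a composition $\alpha=(\alpha_1,\ldots,\alpha_s)$ of $n-1$ (positive integers with sum $n-1$), the fence poset $F(\alpha)$ has elements $x_1,\ldots,x_n$. For $1\le i\le s$ its $i$th segment is the set $\{x_j : \alpha_1+\cdots+\alpha_{i-1}+1\le j\le \alpha_1+\cdots+\alpha_i+1\}$. The covering relations are: consecutive elements of the $i$th segment satisfy $x_j\lhd x_{j+1}$ if $i$ is odd and $x_j\rhd x_{j+1}$ if $i$ is even. $L(\alpha)$ is the lattice of all lower order ideals of $F(\alpha)$, ranked by cardinality; $r_k(\alpha)$ is the number of order ideals of $F(\alpha)$ of cardinality $k$, and $r(q;\alpha)=\sum_{k\ge0} r_k(\alpha)q^k$. A polynomial with nonnegative coefficients is unimodal if its coefficient sequence $a_0,\ldots,a_n$ satisfies $a_0\le\cdots\le a_m\ge\cdots\ge a_n$ for some $m$. *)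

(* Defs.v *)
From HB Require Import structures.
From mathcomp Require Import all_boot all_order all_algebra.

Set Implicit Arguments.
Unset Strict Implicit.
Unset Printing Implicit Defensive.

Import Order.TTheory GRing.Theory Num.Theory.

Definition is_composition (alpha : seq nat) : bool := all (ltn 0) alpha.

(* Indices start at 0: the ordinal j stands for x_(j+1), and segment number i
   stands for the (i+1)-st one; hence the even-numbered segments go up.
   An alias of the ordinals is used because they already carry the usual
   order. *)
Definition fence (alpha : seq nat) : Type := 'I_(sumn alpha).+1.

HB.instance Definition _ (alpha : seq nat) := Finite.on (fence alpha).

Definition fence_segment (alpha : seq nat) (i : nat) : {set fence alpha} :=
  [set x : fence alpha |
    sumn (take i alpha) <= nat_of_ord x <= sumn (take i.+1 alpha)].

Definition fence_cover (alpha : seq nat) : rel (fence alpha) := fun x y =>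
  [exists i : 'I_(size alpha),
    [&& x \in fence_segment alpha i, y \in fence_segment alpha i &
        if odd i then nat_of_ord x == (nat_of_ord y).+1
        else nat_of_ord y == (nat_of_ord x).+1]].

Definition fence_le (alpha : seq nat) : rel (fence alpha) :=
  connect (@fence_cover alpha).

(* Antisymmetry of fence_le: every covering step raises fence_height by 1. *)
Definition step_up (alpha : seq nat) (j : nat) : bool :=
  [exists i : 'I_(size alpha),
    ~~ odd i && (sumn (take i alpha) <= j < sumn (take i.+1 alpha))].

Definition fence_height (alpha : seq nat) (x : fence alpha) : int :=
  (\sum_(0 <= j < nat_of_ord x) (if step_up alpha j then 1 else -1))%R.

Lemma sumn_take_le alpha i k :
  i <= k -> sumn (take i alpha) <= sumn (take k alpha).
Proof.
move=> le_ik; rewrite -(subnKC le_ik) takeD sumn_cat; exact: leq_addr.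
Qed.

Lemma fence_cover_height alpha (x y : fence alpha) :
  fence_cover x y -> fence_height y = (fence_height x + 1)%R.
Proof.
case/existsP=> i /and3P[]; rewrite !inE => /andP[xl xu] /andP[yl yu].
case odi: (odd i) => /eqP e; rewrite /fence_height e big_nat_recr //=.
  rewrite ifF ?subrK //; apply/negbTE/existsP=> -[k /andP[evk /andP[kl ku]]].
  case: (ltngtP i k) => [ik|ki|eik]; last by rewrite -eik odi in evk.
    have := leq_trans (leq_trans xu (sumn_take_le alpha ik)) kl.
    by rewrite e ltnn.
  by have := leq_trans (leq_trans ku (sumn_take_le alpha ki)) yl; rewrite ltnn.
by rewrite ifT //; apply/existsP; exists i; rewrite odi xl -e.
Qed.

Lemma fence_path_height alpha (x : fence alpha) p :
  path (@fence_cover alpha) x p ->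
  fence_height (last x p) = (fence_height x + (size p)%:R)%R.
Proof.
elim: p x => [|y p IHp] x /=; first by rewrite addr0.
by case/andP=> /fence_cover_height hxy /IHp ->; rewrite hxy -addrA -mulrS.
Qed.

Lemma fence_le_refl alpha : reflexive (@fence_le alpha).
Proof. exact: connect0. Qed.

Lemma fence_le_anti alpha : antisymmetric (@fence_le alpha).
Proof.
move=> x y /andP[/connectP[p hp ->] /connectP[q hq hx]].
have := fence_path_height hq; rewrite -hx (fence_path_height hp) -addrA -natrD.
move/eqP; rewrite -subr_eq0 opprD addNKr oppr_eq0 pnatr_eq0 addn_eq0.
by case/andP=> /nilP ->.
Qed.

Lemma fence_le_trans alpha : transitive (@fence_le alpha).
Proof. exact: connect_trans. Qed.

Fact fence_display : Order.disp_t. Proof. exact: Order.Disp tt tt. Qed.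

HB.instance Definition _ (alpha : seq nat) :=
  Order.Le_isPOrder.Build fence_display (fence alpha)
    (@fence_le_refl alpha) (@fence_le_anti alpha) (@fence_le_trans alpha).

Lemma fence_coverP alpha (x y : fence alpha) :
  reflect ((x < y)%O /\ forall z : fence alpha, ~~ (x < z < y)%O)
          (fence_cover x y).
Proof.
have lt_height (u v : fence alpha) :
    (u < v)%O -> (fence_height u + 1 <= fence_height v)%R.
  rewrite lt_neqAle => /andP[neq /connectP[[|w p] hp def_v]].
    by rewrite def_v eqxx in neq.
  by rewrite def_v (fence_path_height hp) lerD2l /= ler1n.
apply: (iffP idP) => [cxy | [ltxy nz]].
  have hxy := fence_cover_height cxy; split=> [|z].
    rewrite lt_neqAle; apply/andP; split; last exact: connect1.
    apply/eqP=> exy; move/eqP: hxy.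
    by rewrite exy -subr_eq0 opprD addNKr oppr_eq0 oner_eq0.
  apply/negP=> /andP[/lt_height xz /lt_height].
  by rewrite hxy lerD2r => /(le_trans xz); rewrite gerDl ler10.
have := ltxy; rewrite lt_neqAle => /andP[neq /connectP[[|w p] /=]].
  by move=> _ def_y; rewrite def_y eqxx in neq.
case/andP=> cxw hp def_y; have lexw : (x <= w)%O by exact: connect1.
have lewy : (w <= y)%O by apply/connectP; exists p.
have neqxw : x != w.
  apply/eqP=> exw; have /eqP := fence_cover_height cxw.
  by rewrite exw -subr_eq0 opprD addNKr oppr_eq0 oner_eq0.
have := nz w; rewrite !lt_neqAle neqxw lexw lewy !andbT negbK.
by move/eqP <-.
Qed.

Definition is_order_ideal d (P : finPOrderType d) (I : {set P}) : bool :=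
  [forall y in I, forall x : P, (x <= y)%O ==> (x \in I)].

Definition rank_count (alpha : seq nat) (k : nat) : nat :=
  #|[set I : {set fence alpha} | is_order_ideal I & #|I| == k]|.

(* No ideal has more than #|fence alpha| elements, so this is the sum over
   all k >= 0. *)
Definition rank_poly (alpha : seq nat) : {poly nat} :=
  (\poly_(k < #|{: fence alpha}|.+1) rank_count alpha k)%R.

(* Coefficients in nat, i.e. nonnegative; (size p).-1 is the degree of p. *)
Definition unimodal (p : {poly nat}) : Prop :=
  exists2 m : nat, m <= (size p).-1 &
    (forall i : nat, i < m -> (p`_i)%R <= (p`_i.+1)%R) /\
    (forall i : nat, m <= i < (size p).-1 -> (p`_i.+1)%R <= (p`_i)%R).

(* Main.v *)
(** Let [b] be the last part of [alpha], [a] the sum of the other parts, and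
    [c_0 < ... < c_b] the last segment, listed in increasing order in the fence.
    An ideal meets this chain in an initial part.  Adding to an ideal its first
    missing chain element is injective (the element added is the last chain
    element of the result), and so is removing its last chain element.

    The chain meets the rest of the fence only in one of its ends, which is a
    minimal element [c_0] if the last segment goes up and a maximal element
    [c_b] if it goes down.  Put [e = 1] in the first case and [e = 0] in the
    second.  Then [c_j] may be added when [j < b + e] and removed when
    [e <= j], so the ranks increase up to [b + e] and decrease from [a + e]
    on; as [a <= b] this covers everything. *)

Require Import Defs.
From mathcomp Require Import all_boot all_order all_algebra.
From mathcomp Require Import zify.

(** * Families of sets that meet a chain in initial parts *)

Section ChainInFamily.

Variables (T : finType) (F : {set {set T}}) (c : nat -> T) (N : nat).
Hypothesis c_inj : forall i j, i < N -> j < N -> c i = c j -> i = j.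
Hypothesis c_down :
  forall I j, I \in F -> j.+1 < N -> c j.+1 \in I -> c j \in I.

Let C := [set c (nat_of_ord j) | j : 'I_N].

Lemma card_chain : #|C| = N.
Proof.
rewrite card_imset ?card_ord // => i j eij.
by apply/val_inj/(c_inj _ _ (ltn_ord i) (ltn_ord j) eij).
Qed.

Lemma mem_chain j : j < N -> c j \in C.
Proof. by move=> jN; apply/imsetP; exists (Ordinal jN). Qed.

(** By [c_down], [I] meets the chain in an initial part, whose length must be [#|I :&: C|]. With [t]
    this length, the first missing element is [c t] and the last present one [c t.-1]. *)
Lemma mem_chain_card I j : I \in F -> j < N -> (c j \in I) = (j < #|I :&: C|).
Proof.
move=> IF.
have [m [mN mP]] : exists m, m <= N /\ forall i, i < N -> (c i \in I) = (i < m).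
  have: forall n, n <= N ->
      exists m, m <= n /\ forall i, i < n -> (c i \in I) = (i < m).
    elim=> [|n IHn] nN; first by exists 0.
    have [m [mn mP]] := IHn (ltnW nN).
    have [cn|cn] := boolP (c n \in I); last first.
      exists m; split=> [|i]; first exact: leqW.
      rewrite ltnS leq_eqVlt => /orP[/eqP->|/mP//].
      by rewrite (negbTE cn) ltnNge mn.
    have all_in k : k <= n -> c (n - k) \in I.
      elim: k => [|k IHk] kn; first by rewrite subn0.
      by apply: (c_down _ _ IF); rewrite subnSK // ?IHk; lia.
    exists n.+1; split=> // i i_n.
    by rewrite i_n -(subKn (m := i) (n := n)) ?all_in ?leq_subr.
  by move/(_ N (leqnn N)).
suff -> : #|I :&: C| = m by apply: mP.
have -> : I :&: C = [set c (nat_of_ord i) | i in [set i : 'I_N | i < m]].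
  apply/setP=> x; rewrite inE; apply/andP/imsetP.
    case=> xI /imsetP[i _ def_x]; exists i => //.
    by rewrite inE -mP // -def_x.
  case=> i; rewrite inE => im ->; split; last exact: mem_chain.
  by rewrite mP.
rewrite card_imset; last first.
  by move=> i j' eij; apply/val_inj/(c_inj _ _ (ltn_ord i) (ltn_ord j') eij).
rewrite -sum1dep_card (big_ord_narrow mN) /=.
by rewrite sum1_card card_ord.
Qed.

Lemma leq_card_add_chain m k :
    (forall I j, I \in F -> j < m -> c j \notin I ->
       (forall i, i < j -> c i \in I) -> c j |: I \in F) ->
    m <= N -> k < m ->
  #|[set I in F | #|I| == k]| <= #|[set I in F | #|I| == k.+1]|.
Proof.
move=> addF mN km; pose t I := #|I :&: C|; pose f I := c (t I) |: I.
(* A set with [k] elements has at most [k] of them on the chain, so the first missing index stays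
   below [m]. *)
have tk (I : {set T}) : #|I| = k -> t I < m.
  by move=> Ik; apply: leq_ltn_trans km; rewrite -Ik subset_leq_card ?subsetIl.
have fresh (I : {set T}) : I \in F -> #|I| = k -> c (t I) \notin I.
  by move=> IF /tk tm; rewrite mem_chain_card ?ltnn ?(leq_trans tm).
have tf (I : {set T}) : I \in F -> #|I| = k -> t (f I) = (t I).+1.
  move=> IF Ik; rewrite /t /f setIUl -/(t I).
  have /setIidPl -> : [set c (t I)] \subset C.
    by rewrite sub1set mem_chain ?(leq_trans (tk I Ik)).
  by rewrite cardsU1 inE (negbTE (fresh I IF Ik)).
have f_inj : {in [set I in F | #|I| == k] &, injective f}.
  move=> I J; rewrite !inE => /andP[IF /eqP Ik] /andP[JF /eqP Jk] efIJ.
  have etIJ : t I = t J by apply: succn_inj; rewrite -!tf // efIJ.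
  by rewrite -(setU1K (fresh I IF Ik)) -(setU1K (fresh J JF Jk)) -/(f I) efIJ etIJ.
rewrite -(card_in_imset f_inj).
apply/subset_leq_card/subsetP=> _ /imsetP[I + ->].
rewrite !inE => /andP[IF /eqP Ik].
rewrite cardsU1 fresh // Ik add1n eqxx andbT addF ?fresh ?tk // => i it.
by rewrite mem_chain_card // (leq_trans it) // (leq_trans _ mN) // ltnW ?tk.
Qed.

Lemma leq_card_remove_chain l k :
    (forall I j, I \in F -> l <= j < N -> c j \in I ->
       (j.+1 < N -> c j.+1 \notin I) -> I :\ c j \in F) ->
    #|T| - N + l <= k ->
  #|[set I in F | #|I| == k.+1]| <= #|[set I in F | #|I| == k]|.
Proof.
move=> remF lk; pose t I := #|I :&: C|; pose f I := I :\ c (t I).-1.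
have tN (I : {set T}) : t I <= N
  by rewrite -card_chain subset_leq_card ?subsetIr.
(* Only [#|T| - N] elements lie off the chain, so more than [l] elements of [I] lie on it, and the
   index [(t I).-1] to remove is at least [l]. *)
have tk (I : {set T}) : #|I| = k.+1 -> l < t I.
  have := cardsID C I; rewrite -/(t I).
  have := cardsC C; rewrite card_chain.
  have : #|I :\: C| <= #|~: C| by rewrite setDE subset_leq_card ?subsetIr.
  lia.
have topC (I : {set T}) : #|I| = k.+1 -> (t I).-1 < N.
  by move=> /tk tl; rewrite prednK ?(leq_ltn_trans _ tl).
have top (I : {set T}) : I \in F -> #|I| = k.+1 -> c (t I).-1 \in I.
  move=> IF Ik; rewrite mem_chain_card ?topC // -/(t I).
  by have := tk I Ik; case: (t I).
have tf (I : {set T}) : I \in F -> #|I| = k.+1 -> t I = (t (f I)).+1.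
  move=> IF Ik; rewrite {1}/t (cardsD1 (c (t I).-1)) inE top ?mem_chain ?topC //.
  by rewrite -setIDAC.
have f_inj : {in [set I in F | #|I| == k.+1] &, injective f}.
  move=> I J; rewrite !inE => /andP[IF /eqP Ik] /andP[JF /eqP Jk] efIJ.
  have etIJ : t I = t J by rewrite (tf I) // (tf J) // efIJ.
  by rewrite -(setD1K (top I IF Ik)) -(setD1K (top J JF Jk)) -/(f I) efIJ etIJ.
rewrite -(card_in_imset f_inj).
apply/subset_leq_card/subsetP=> _ /imsetP[I + ->].
rewrite !inE => /andP[IF /eqP Ik]; apply/andP; split.
  have t_gt0 : 0 < t I by apply: leq_ltn_trans (tk I Ik).
  apply: remF; rewrite ?top ?topC ?andbT // ?prednK //.
    by rewrite -ltnS prednK ?tk.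
  by move=> tN'; rewrite mem_chain_card // ltnn.
by rewrite -eqSS -Ik (cardsD1 (c (t I).-1) I) top.
Qed.

End ChainInFamily.

(** The order is the reflexive transitive closure of the covers, so closure under single covers
    propagates along paths. *)
Lemma order_ideal_coverP alpha (I : {set fence alpha}) :
  reflect (forall x y, fence_cover x y -> y \in I -> x \in I)
          (is_order_ideal I).
Proof.
apply: (iffP forall_inP) => [idI x y xy yI | clI y yI].
  by apply: (implyP (forallP (idI y yI) x)); apply: connect1.
apply/forallP=> x; apply/implyP=> /connectP[p]; elim: p x => [|z p IHp] x /=.
  by move=> _ <-.
by case/andP=> xz /IHp {}IHp /IHp; apply: clI.
Qed.

(** * The last segment of the fence as a chain *)

Section LastSegment.

Variables (al : seq nat) (b : nat).
Hypothesis al_gt0 : is_composition al.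
Let alpha := rcons al b.
Let a := sumn al.

Lemma fence_lt (x : fence alpha) : x <= a + b.
Proof. by rewrite -ltnS -sumn_rcons; apply: ltn_ord. Qed.

(** Positivity of the parts enters here: every segment before the last two ends strictly before
    position [a]. *)
Lemma sumn_take_lt i : i < size al -> sumn (take i al) < a.
Proof.
move=> ial; rewrite /a -{2}(cat_take_drop i al) sumn_cat (drop_nth 0) //=.
have /= nth_gt0 := allP al_gt0 _ (mem_nth 0 ial).
by rewrite -addn1 leq_add2l ltn_addr.
Qed.

(* Near [x_(a+1)] the last segment and the one before it go in opposite
   directions. *)
Lemma fence_cover_last (x y : fence alpha) :
    fence_cover x y -> a <= maxn x y ->
  if (a < maxn x y) == ~~ odd (size al) then nat_of_ord y = x.+1
  else nat_of_ord x = y.+1.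
Proof.
case/existsP=> -[i i_lt] /and3P[]; rewrite !inE /= => /andP[xl xu] /andP[yl yu].
move: i_lt; rewrite size_rcons ltnS leq_eqVlt => /orP[/eqP ei|i_al] dir axy.
  have ea : sumn (take i alpha) = a by rewrite ei /alpha -cats1 take_size_cat.
  rewrite ea in xl yl; rewrite -ei.
  have -> : a < maxn x y by move: dir; case: odd => /eqP; lia.
  by move: dir; case: odd => /eqP.
have take_al : sumn (take i.+1 alpha) = sumn (take i.+1 al).
  by rewrite /alpha -cats1 takel_cat.
rewrite take_al in xu yu.
(* Since the cover reaches position [a], its segment cannot end earlier; it is the last but one, and
   ends exactly at [a]. *)
have ei : i.+1 = size al.
  apply/eqP; rewrite eqn_leq i_al leqNgt; apply/negP=> /sumn_take_lt; lia.
rewrite ei take_size -/a in xu yu; rewrite -ei /=.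
have -> : (a < maxn x y) = false by lia.
by move: dir; case: odd => /eqP.
Qed.

Lemma last_segment_cover (x y : fence alpha) :
    a <= minn x y ->
    (if odd (size al) then nat_of_ord x = y.+1 else nat_of_ord y = x.+1) ->
  fence_cover x y.
Proof.
move=> axy dir; apply/existsP.
have i_lt : size al < size alpha by rewrite size_rcons.
exists (Ordinal i_lt); rewrite !inE /=.
have -> : take (size al) alpha = al by rewrite /alpha -cats1 take_size_cat.
have -> : sumn (take (size al).+1 alpha) = a + b.
  by rewrite take_oversize ?size_rcons ?sumn_rcons.
rewrite -/a !fence_lt.
have [-> ->] : a <= x /\ a <= y by lia.
by move: dir; case: odd => ->; rewrite eqxx.
Qed.

Let ideals := [set I : {set fence alpha} | is_order_ideal I].
Let e : nat := ~~ odd (size al).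
(** Counting from 0, the last segment has number [size al], so it goes down when this is odd;
    positions are then reversed to list the chain upwards. *)
Let c (j : nat) : fence alpha :=
  inord (if odd (size al) then a + b - j else a + j).

Lemma val_chain j :
  j < b.+1 -> c j = (if odd (size al) then a + b - j else a + j) :> nat.
Proof. by move=> jb; rewrite inordK // sumn_rcons -/a; case: odd; lia. Qed.

Lemma eq_chain j (x : fence alpha) : j < b.+1 ->
  nat_of_ord x = (if odd (size al) then a + b - j else a + j) -> x = c j.
Proof. by move=> jb ex; apply: val_inj; rewrite /= ex -val_chain. Qed.

Lemma chain_inj i j : i < b.+1 -> j < b.+1 -> c i = c j -> i = j.
Proof.
move=> ib jb /(congr1 (@nat_of_ord _)); rewrite !val_chain //.
by case: odd; lia.
Qed.

Lemma chain_down I j : I \in ideals -> j.+1 < b.+1 -> c j.+1 \in I -> c j \in I.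
Proof.
rewrite inE => /order_ideal_coverP clI jb; apply: clI.
by apply: last_segment_cover; rewrite !val_chain ?(ltnW jb) //; case: odd; lia.
Qed.

(** For [j < b + e], an element covered by [c j] can only be [c j.-1]. The bound leaves out [c b]
    when the segment goes down, as it may also cover an element of the preceding segment. *)
Lemma chain_add (I : {set fence alpha}) j :
    I \in ideals -> j < b + e -> c j \notin I ->
  (forall i, i < j -> c i \in I) -> c j |: I \in ideals.
Proof.
rewrite !inE => /order_ideal_coverP clI jbe cjI lt_j.
have jb : j < b.+1 by move: jbe; rewrite /e; case: odd; lia.
apply/order_ideal_coverP=> x y xy; rewrite !inE => /orP[/eqP ey|/(clI x y xy)->];
  last by rewrite orbT.
have vy := val_chain _ jb; rewrite -ey in vy.
have := fence_cover_last _ _ xy; have := fence_lt x; have := fence_lt y.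
move: jbe vy; rewrite /e; case odd_al: (odd (size al)) => /= jbe vy yn xn cv.
  have {}cv : nat_of_ord x = y.+1.
    by have := cv ltac:(lia); rewrite ifF //; lia.
  (* Here [j] is positive: [j = 0] would put [x] beyond position [a + b]. *)
  suff -> : x = c j.-1 by rewrite lt_j ?orbT //; lia.
  by apply: eq_chain; rewrite ?odd_al; lia.
have := cv ltac:(lia); case: ifP => cmp {}cv; last by lia.
suff -> : x = c j.-1 by rewrite lt_j ?orbT //; lia.
by apply: eq_chain; rewrite ?odd_al; lia.
Qed.

(** Dually, for [e <= j] only [c j.+1] can cover [c j]. The bound leaves out [c 0] when the segment
    goes up, as an element of the preceding segment may also cover it. *)
Lemma chain_remove (I : {set fence alpha}) j :
    I \in ideals -> e <= j < b.+1 -> c j \in I ->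
  (j.+1 < b.+1 -> c j.+1 \notin I) -> I :\ c j \in ideals.
Proof.
rewrite !inE => /order_ideal_coverP clI /andP[ej jb] cjI last_j.
apply/order_ideal_coverP=> x y xy; rewrite !inE => /andP[_ yI].
rewrite (clI x y xy yI) andbT; apply/eqP=> ex.
suff [jb' ey] : j.+1 < b.+1 /\ y = c j.+1.
  by have := last_j jb'; rewrite -ey yI.
have vx := val_chain _ jb; rewrite -ex in vx.
have := fence_cover_last _ _ xy; have := fence_lt x; have := fence_lt y.
move: ej vx; rewrite /e; case odd_al: (odd (size al)) => /= ej vx yn xn cv.
  have := cv ltac:(lia); case: ifP => cmp {}cv; first by lia.
  have jb' : j.+1 < b.+1 by lia.
  by split=> //; apply: eq_chain; rewrite ?odd_al; lia.
have {}cv : nat_of_ord y = x.+1.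
  by have := cv ltac:(lia); rewrite ifT //; lia.
have jb' : j.+1 < b.+1 by lia.
by split=> //; apply: eq_chain; rewrite ?odd_al; lia.
Qed.

Lemma rank_count_ideals k :
  rank_count alpha k = #|[set I in ideals | #|I| == k]|.
Proof. by apply: eq_card => I; rewrite !inE. Qed.

Lemma rank_count_incr k :
  k < b + e -> rank_count alpha k <= rank_count alpha k.+1.
Proof.
move=> kb; rewrite !rank_count_ideals.
apply: (leq_card_add_chain _ _ _ _ chain_inj chain_down _ _ chain_add _ kb).
by rewrite /e; case: odd; lia.
Qed.

Lemma rank_count_decr k :
  a + e <= k -> rank_count alpha k.+1 <= rank_count alpha k.
Proof.
move=> ak; rewrite !rank_count_ideals.
apply: (leq_card_remove_chain _ _ _ _ chain_inj chain_down _ _ chain_remove).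
(* The fence has [a + b + 1] elements and the chain [b + 1], which leaves [a] off the chain. *)
by rewrite card_ord sumn_rcons -/a; lia.
Qed.

End LastSegment.

(** * Degree and coefficients of the rank generating function *)

Lemma rank_count_top alpha : 0 < rank_count alpha #|{: fence alpha}|.
Proof.
apply/card_gt0P; exists setT; rewrite !inE cardsT eqxx andbT.
by apply/order_ideal_coverP=> x y _ _; rewrite inE.
Qed.

(** The whole fence is an ideal, so the top coefficient is nonzero and the degree is the number of
    elements. *)
Lemma size_rank_poly alpha : size (rank_poly alpha) = (sumn alpha).+2.
Proof.
by rewrite size_poly_eq /= ?card_ord // -(card_ord (sumn alpha).+1) -lt0n
   rank_count_top.
Qed.

Lemma coef_rank_poly alpha k :
  k < (sumn alpha).+2 -> ((rank_poly alpha)`_k)%R = rank_count alpha k.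
Proof. by move=> kn; rewrite coef_poly card_ord kn. Qed.

Theorem theorem2p4 (alpha : seq nat) (halpha : is_composition alpha)
    (hs : 0 < size alpha)
    (hlast : \sum_(i < (size alpha).-1) nth 0 alpha i
               <= nth 0 alpha (size alpha).-1) :
  unimodal (rank_poly alpha).
Proof.
case/lastP: alpha halpha hs hlast => // al b.
rewrite /is_composition all_rcons => /andP[_ al_gt0] _.
rewrite size_rcons /= nth_rcons ltnn eqxx => hlast.
have {hlast} ab : sumn al <= b.
  rewrite sumnE (big_nth 0) big_mkord; apply: leq_trans hlast.
  by apply: leq_sum => i _; rewrite nth_rcons ltn_ord.
have e_le1 := leq_b1 (~~ odd (size al)).
(* The peak is put where the increasing range ends; the decreasing range, from
   [sumn al + ~~ odd (size al)] on, has begun by then because of [ab]. *)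
exists (b + ~~ odd (size al)); rewrite size_rank_poly sumn_rcons /=.
  by lia.
split=> i ib; rewrite !coef_rank_poly ?sumn_rcons; try by lia.
  exact: rank_count_incr.
apply: rank_count_decr => //; lia.
Qed.
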